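(* Let $L$ be a dcpo. The following two conditions are equivalent: (1) $L$ is a strongly continuous domain; (2) for every $x\in L$, the set $\Downarrow_s x$ is directed, $x=\sup \Downarrow_s x$, and $\Uparrow_s x\in\sigma_s(L)$.
   Context: A dcpo is a poset in which every directed subset (directed sets are nonempty) has a supremum. For $x\in L$ and $A\subseteq L$: $\uparrow x=\{y\in L: x\le y\}$, $\uparrow A=\bigcup_{a\in A}\uparrow a$; an upper set is a set $U$ with $U=\uparrow U$. Strong Scott topology: a subset $U\subseteq L$ is strongly Scott open if $U$ is an upper set and for every directed $D\subseteq L$ and every $x\in L$, $\bigcap_{d\in D}\uparrow d\cap\uparrow x\subseteq U$ implies $\uparrow d\cap\uparrow x\subseteq U$ for some $d\in D$. Let $\sigma^s(L)$ be the set of all strongly Scott open subsets. It is closed under binary intersections, and the strong Scott topology $\sigma_s(L)$ is the topology having $\sigma^s(L)$ as a base. A dcpo $L$ is a strongly continuous domain if for every $U\in\sigma_s(L)$ and $x\in U$ there is $u\in U$ with $x\in\mathrm{int}_{\sigma_s(L)}\uparrow u\subseteq\uparrow u\subseteq U$ (i.e. $(L,\sigma_s(L))$ is a C-space). Strong way-below relation: $x\ll_s y$ iff for every directed $D\subseteq L$ and every $a\in L$, $\bigcap_{d\in D}\uparrow d\cap\uparrow a\subseteq\uparrow y$ implies $\uparrow d\cap\uparrow a\subseteq\uparrow x$ for some $d\in D$. Write $\Downarrow_s x=\{y\in L: y\ll_s x\}$ and $\Uparrow_s x=\{y\in L: x\ll_s y\}$. *)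

(* Defs.v *)
From HB Require Import structures.
From mathcomp Require Import all_boot all_order.
From mathcomp Require Import all_classical.
From mathcomp Require Import topology_structure.

Set Implicit Arguments.
Unset Strict Implicit.
Unset Printing Implicit Defensive.

Import Order.TTheory.
Local Open Scope classical_set_scope.
Local Open Scope order_scope.

Section StrongScott.
Context {disp : Order.disp_t} {L : porderType disp}.
Implicit Types (x y a : L) (A U D : set L).

Definition directed D : Prop :=
  D !=set0 /\
  forall x y, D x -> D y -> exists z, [/\ D z, x <= z & y <= z].

Definition upper x : set L := [set y | x <= y].

Definition upper_closure A : set L := \bigcup_(a in A) upper a.

Definition upper_set U : Prop := U = upper_closure U.

Definition strongly_scott_open U : Prop :=
  upper_set U /\
  forall D x, directed D ->
    (\bigcap_(d in D) upper d) `&` upper x `<=` U ->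
    exists2 d, D d & upper d `&` upper x `<=` U.

Definition strong_way_below x y : Prop :=
  forall D a, directed D ->
    (\bigcap_(d in D) upper d) `&` upper a `<=` upper y ->
    exists2 d, D d & upper d `&` upper a `<=` upper x.

Definition strong_lower x : set L := [set y | strong_way_below y x].

Definition strong_upper x : set L := [set y | strong_way_below x y].

End StrongScott.

Definition dcpo (disp : Order.disp_t) (L : porderType disp) : Prop :=
  forall D : set L, directed D -> exists s, isLub D s.

(* The poset [L], retyped so as to carry the topology sigma_s(L); its open sets
   are the unions of strongly Scott open sets, not only the latter. *)
Definition strong_scott {disp : Order.disp_t} (L : porderType disp) : Type := L.

Section StrongScottTopology.
Context {disp : Order.disp_t} {L : porderType disp}.

HB.instance Definition _ := Order.POrder.copy (strong_scott L) L.

Lemma strongly_scott_openT : strongly_scott_open [set: L].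
Proof.
split; last by move=> D x [[d Dd] _] _; exists d.
by apply/seteqP; split=> // x _; exists x => //=; rewrite /upper /=.
Qed.

Lemma strongly_scott_openI (U V : set L) :
  strongly_scott_open U -> strongly_scott_open V ->
  strongly_scott_open (U `&` V).
Proof.
move=> [uU oU] [uV oV]; split.
  apply/seteqP; split=> [x UVx|y [x [Ux Vx] xy]].
    by exists x => //=; rewrite /upper /=.
  by split; [rewrite uU|rewrite uV]; exists x.
move=> D x dD; rewrite subsetI => -[/(oU _ _ dD)[d Dd dU] /(oV _ _ dD)[e De eV]].
have [f [Df df ef]] := dD.2 _ _ Dd De.
exists f => // y [fy xy]; split.
  by apply: dU; split=> //; exact: le_trans df fy.
by apply: eV; split=> //; exact: le_trans ef fy.
Qed.

Let base_cover :
  \bigcup_(U in @strongly_scott_open _ L) U = [set: strong_scott L].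
Proof.
by apply/seteqP; split=> // x _; exists setT => //; exact: strongly_scott_openT.
Qed.

Let base_join (U V : set L) (x : strong_scott L) :
  strongly_scott_open U -> strongly_scott_open V -> U x -> V x ->
  exists W : set L, [/\ strongly_scott_open W, W x & W `<=` U `&` V].
Proof.
by move=> oU oV Ux Vx; exists (U `&` V); split=> //; exact: strongly_scott_openI.
Qed.

HB.instance Definition _ := @isBaseTopological.Build (strong_scott L)
  (set L) (@strongly_scott_open _ L) id base_cover base_join.

End StrongScottTopology.

Definition strongly_continuous (disp : Order.disp_t) (L : porderType disp) :
    Prop :=
  forall (U : set (strong_scott L)) (x : strong_scott L), open U -> U x ->
  exists u : strong_scott L,
    [/\ U u, interior (upper u) x, interior (upper u) `<=` upper u
      & upper u `<=` U].

(* Main.v *)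
Require Import Defs.
From mathcomp Require Import all_boot all_order.
From mathcomp Require Import all_classical.
From mathcomp Require Import topology_structure.

(** The theorem rests on the identity
      [x << u  <->  u \in interior (upper x)]
    between the strong way-below relation and the interior of principal upper
    sets, where [x << u] stands for [strong_way_below x u].  One direction
    holds in every poset ([interior_upper_swb]): a basic open set squeezed
    between [u] and [upper x] turns the defining property of strongly Scott
    open sets into that of [<<].

    When the space is a C-space, the set [approx x] of those [v] with [x] in
    the interior of [upper v] is directed, by applying the C-space property to
    intersections of two such interiors, and it has supremum [x], because the
    complement of a principal lower set is strongly Scott open
    ([strongly_scott_open_nle]) and hence the opens separate [x] from any
    element not above it.  Testing [v << x] against this very set gives
    the other direction of the identity ([swb_interior_upper]), so
    [strong_lower x] is [approx x] and [strong_upper x] is the interior of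
    [upper x].

    Conversely, if [strong_lower x] is directed with supremum [x], every
    basic open set containing [x] contains a point [e << x]; as
    [strong_upper e] is open and lies inside [upper e], it witnesses that [x]
    is interior to [upper e].

    Both halves use that for a directed set [D] with supremum [x], taking the
    auxiliary element [a] of the definitions inside [D] makes
    [upper d `&` upper a] contain a single [upper e] with [e] in [D]; testing
    either definition on [D] thus puts an element of [D] itself in the target
    set ([directed_lub_inaccessible]). *)

Set Implicit Arguments.
Unset Strict Implicit.
Unset Printing Implicit Defensive.

Import Order.TTheory.
Local Open Scope classical_set_scope.
Local Open Scope order_scope.

Section StrongScottTheory.
Context {disp : Order.disp_t} {L : porderType disp}.
Implicit Types (x y u v a b : L) (D U V : set L).

Lemma strongly_scott_open_up U x y :
  strongly_scott_open U -> U x -> x <= y -> U y.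
Proof. by move=> [uU _] Ux xy; rewrite uU; exists x. Qed.

(** The premise on [U] holds both when [U] is strongly Scott open and contains
    [x], and when [U := upper v] with [strong_way_below v x].  Choosing [a] in
    [D] absorbs the factor [upper a]: a common upper bound in [D] of [a] and the
    resulting [d] lies in [upper d `&` upper a]. *)
Lemma directed_lub_inaccessible D x U :
  directed D -> isLub D x ->
  (forall a, (\bigcap_(d in D) upper d) `&` upper a `<=` upper x ->
    exists2 d, D d & upper d `&` upper a `<=` U) ->
  exists2 e, D e & U e.
Proof.
move=> dD [_ lubx] HU; have [a Da] := dD.1.
have [b [ubb _]|d Dd dU] := HU a; first by apply: lubx => d /ubb.
have [e [De de ae]] := dD.2 _ _ Dd Da.
by exists e => //; apply: dU.
Qed.

Lemma swb_le x y : strong_way_below x y -> x <= y.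
Proof.
move=> xy; have dy : directed [set y].
  by split=> [|_ _ -> ->]; exists y.
have [b [_ yb] //|_ -> ylex] := xy _ y dy.
exact: (ylex y (conj (lexx y) (lexx y))).
Qed.

(** If [b] bounds [D] and [a], then [b] itself lies in the intersection of
    their principal upper sets; so when that intersection avoids the lower set
    of [b], already [a] or one [d] is not below [b]. *)
Lemma strongly_scott_open_nle b : strongly_scott_open [set y | ~ y <= b].
Proof.
split.
  apply/seteqP; split=> [y yb|y [z zb zy] yb]; first by exists y; rewrite /upper /=.
  by apply: zb; exact: le_trans zy yb.
move=> D a dD Db.
have [d Dd db] : exists2 d, D d & (~ d <= b \/ ~ a <= b).
  apply: contrapT => noD; apply: (Db b); last exact: lexx.
  have Dab d : D d -> d <= b /\ a <= b.
    by move=> Dd; split; apply: contrapT => nb; apply: noD; exists d; auto.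
  split=> [d /Dab[]//|].
  by have [d /Dab[]] := dD.1.
exists d => // y [dy ay] yb.
by case: db; apply; [exact: le_trans dy yb|exact: le_trans ay yb].
Qed.

Lemma open_strongly_scott U :
  strongly_scott_open U -> open (U : set (strong_scott L)).
Proof.
move=> oU; exists [set U]; first by move=> _ ->.
by rewrite bigcup_set1.
Qed.

Lemma open_strongly_scott_base (U : set (strong_scott L)) x :
  open U -> U x -> exists V, [/\ strongly_scott_open V, V x & V `<=` U].
Proof.
move=> [B oB <-] [V BV Vx]; exists V; split=> //; first exact: oB.
by move=> y Vy; exists V.
Qed.

(** Named so that the interior is always the one for the strong Scott topology,
    which [L] itself does not carry. *)
Definition interior_upper u : set L := interior (upper u : set (strong_scott L)).

Definition approx x : set L := [set v | interior_upper v x].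

Lemma open_interior_upper u : open (interior_upper u : set (strong_scott L)).
Proof. exact: open_interior. Qed.

Lemma interior_upper_le u x : interior_upper u x -> u <= x.
Proof. exact: interior_subset. Qed.

Lemma interior_upper_anti u v : u <= v -> interior_upper v `<=` interior_upper u.
Proof. by move=> uv; apply: (@interiorS (strong_scott L)) => y; exact: le_trans. Qed.

(** The basic open [V] with [x] in [V] and [V] inside [upper u] mediates: a
    bound above [x] lands in the upper set [V], and what openness returns inside
    [V] is inside [upper u]. *)
Lemma interior_upper_swb u x : interior_upper u x -> strong_way_below u x.
Proof.
move=> /(open_strongly_scott_base (open_interior_upper u))[V [oV Vx Vu]] D a dD Dx.
have [|d Dd dV] := oV.2 D a dD.
  by move=> y /Dx xy; exact: strongly_scott_open_up oV Vx xy.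
by exists d => // y /dV /Vu /interior_upper_le.
Qed.

(** The C-space property at the intersection of two interiors gives a [w] lying
    in both, hence above [u] and [v], and still approximating [x]. *)
Lemma approx_directed x : strongly_continuous L -> directed (approx x).
Proof.
move=> sc; split; first by have [u [_ xu _ _]] := sc setT x openT I; exists u.
move=> u v xu xv.
have oI := openI (open_interior_upper u) (open_interior_upper v).
have [w [[wu wv] xw _ _]] := sc _ x oI (conj xu xv).
by exists w; split=> //; exact: interior_upper_le.
Qed.

(** An upper bound [b] not above [x] would be separated from [x] by the open
    complement of its lower set, which then contains an approximant of [x]. *)
Lemma approx_lub x : strongly_continuous L -> isLub (approx x) x.
Proof.
move=> sc; split=> [v /interior_upper_le //|b ubb].
apply: contrapT => xb.
have [u [ub xu _ _]] := sc _ x (open_strongly_scott (strongly_scott_open_nle b)) xb.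
by apply: ub; exact: ubb.
Qed.

(** [approx x] is itself a directed set with supremum [x], so
    [strong_way_below u x] puts some approximant of [x] above [u]. *)
Lemma swb_interior_upper u x :
  strongly_continuous L -> strong_way_below u x -> interior_upper u x.
Proof.
move=> sc ux; have dx := approx_directed x sc.
have [e xe ue] := directed_lub_inaccessible dx (approx_lub x sc)
  (fun a => ux _ a dx).
exact: interior_upper_anti ue _ xe.
Qed.

Lemma strongly_continuous_swbE u x :
  strongly_continuous L -> strong_way_below u x <-> interior_upper u x.
Proof.
by move=> sc; split; [exact: swb_interior_upper|exact: interior_upper_swb].
Qed.

(** The witness for the C-space property is an [e] in [strong_lower x] caught by
    a basic open set; [strong_upper e] is an open neighbourhood of [x] inside
    [upper e]. *)
Lemma strongly_continuous_of_swb :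
  (forall x : L,
     [/\ directed (strong_lower x),
         isLub (strong_lower x) x
       & open (strong_upper x : set (strong_scott L))]) ->
  strongly_continuous L.
Proof.
move=> H U x oU Ux.
have [V [oV Vx VU]] := open_strongly_scott_base oU Ux.
have [dx lubx _] := H x.
have [a Hx|e ex Ve] := directed_lub_inaccessible dx lubx (U := V).
  by apply: oV.2 => // y /Hx; exact: strongly_scott_open_up.
exists e; split; first exact: VU.
- have [_ _ oe] := H e.
  have sub : (strong_upper e : set (strong_scott L)) `<=` upper e.
    by move=> y; exact: swb_le.
  by move: sub; rewrite open_subsetE //; apply.
- exact: interior_subset.
- by move=> y ey; apply: VU; exact: strongly_scott_open_up oV Ve ey.
Qed.

End StrongScottTheory.

Theorem theorem3p6 (disp : Order.disp_t) (L : porderType disp) (hL : dcpo L) :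
  strongly_continuous L <->
  (forall x : L,
     [/\ directed (strong_lower x),
         isLub (strong_lower x) x
       & open (strong_upper x : set (strong_scott L))]).
Proof.
split; last exact: strongly_continuous_of_swb.
move=> sc x.
have lowerE : strong_lower x = approx x.
  by apply/seteqP; split=> u /(strongly_continuous_swbE _ _ sc).
have upperE : strong_upper x = interior_upper x.
  by apply/seteqP; split=> u /(strongly_continuous_swbE _ _ sc).
rewrite lowerE upperE; split; [exact: approx_directed|exact: approx_lub|].
exact: open_interior_upper.
Qed.
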